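(* Let $K$ be a field, $S=K[t_1,\ldots,t_s]$, and let $I\subset S$ be an ideal generated by polynomials $f_1,\ldots,f_q$ in $K[V]$ for some $V\subset\{t_1,\ldots,t_s\}$. Let $\mathfrak{N}=(V)$ be the ideal of $S$ generated by $V$. If all the associated primes of $I$ are generated by monomials, then any associated prime of $I$ is contained in $\mathfrak{N}$ and $IS_{\mathfrak{N}}\cap S=I$.
   Context: $S_{\mathfrak{N}}$ is the localization of $S$ at the prime ideal $\mathfrak{N}$. An associated prime of $I$ is a prime ideal of the form $(I\colon f)$ with $f\in S$. *)

(* Defs.v *)
From HB Require Import structures.
From mathcomp Require Import all_boot all_algebra.
From mathcomp Require Import boolp classical_sets.
From mathcomp Require Import mpoly.

Set Implicit Arguments.
Unset Strict Implicit.
Unset Printing Implicit Defensive.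

Import GRing.Theory.
Local Open Scope ring_scope.
Local Open Scope classical_set_scope.

(* B is meant to be (the carrier of) a subring containing A; the result is
   then the ideal of B generated by A. The empty sum (n = 0) gives 0. *)
Definition ideal_gen_in (R : comNzRingType) (B A : set R) : set R :=
  [set x | exists (n : nat) (b a : 'I_n -> R),
     [/\ forall i, B (b i), forall i, A (a i) & x = \sum_(i < n) b i * a i]].

Definition ideal_gen (R : comNzRingType) (A : set R) : set R :=
  ideal_gen_in setT A.

(* idealr_closed includes properness (1 is not in P). *)
Definition prime_ideal (R : comNzRingType) (P : set R) : Prop :=
  idealr_closed [pred x | x \in P] /\ prime_idealr_closed [pred x | x \in P].

Definition colon (R : comNzRingType) (I : set R) (f : R) : set R :=
  [set g | I (g * f)].

Definition associated_prime (R : comNzRingType) (I P : set R) : Prop :=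
  prime_ideal P /\ exists f : R, P = colon I f.

(* The localization of a domain R at a prime N, realized as the subring
   {a / b | b not in N} of the fraction field of R. *)
Definition localization (R : idomainType) (N : set R) : set {fraction R} :=
  [set x | exists a b : R, ~ N b /\ x = tofrac a / tofrac b].

(* I R_N, the ideal of R_N generated by the image of I. *)
Definition extension (R : idomainType) (N I : set R) : set {fraction R} :=
  ideal_gen_in (localization N) (@tofrac R @` I).

(* J `&` R, for J a subset of the fraction field of R. *)
Definition contraction (R : idomainType) (J : set {fraction R}) : set R :=
  @tofrac R @^-1` J.

(* K[V], the polynomials in which only the variables indexed by V occur. *)
Definition poly_in_vars (K : fieldType) (s : nat) (V : {set 'I_s}) :
    set {mpoly K[s]} :=
  [set p | forall m, m \in msupp p -> forall i, m i != 0%N -> i \in V].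

Definition vars_ideal (K : fieldType) (s : nat) (V : {set 'I_s}) :
    set {mpoly K[s]} :=
  ideal_gen [set p | exists2 i, i \in V & p = 'X_i].

Definition generated_by_monomials (K : fieldType) (s : nat)
    (P : set {mpoly K[s]}) : Prop :=
  exists M : set 'X_{1..s}, P = ideal_gen [set p | exists2 m, M m & p = 'X_[m]].

(* Main.v *)
Require Import Defs.
From HB Require Import structures.
From mathcomp Require Import all_boot all_order all_algebra.
From mathcomp Require Import boolp classical_sets.
From mathcomp Require Import mpoly.

Set Implicit Arguments.
Unset Strict Implicit.
Unset Printing Implicit Defensive.

Import Order.POrderTheory Order.JoinTheory GRing.Theory.
Local Open Scope ring_scope.
Local Open Scope classical_set_scope.

(** Let [P = (I : x)] be an associated prime of [I].  Being prime and generated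
    by monomials, [P] is generated by variables.  A variable outside [V] is a
    nonzerodivisor modulo [I], because [I] is extended from [K[V]]
    ([var_regular_mod]); if it were in [P] it would kill [x] modulo [I], so [x]
    would be in [I] and [P] would not be proper.  Hence [P] is generated by
    variables of [V], and lies in [(V)] ([associated_prime_sub_vars]).

    For the second claim, [(V)] is prime, as the kernel of the substitution of
    [0] for the variables of [V] ([vars_ideal_prime]).  So [x] is in the
    contraction of the extension of [I] exactly when [c * x] is in [I] for some
    [c] outside [(V)] ([contraction_extensionP]).  If [x] were not in [I], then
    [c] would be a zero divisor modulo [I] and would belong to an associated
    prime ([zero_divisor_in_associated_prime]), which is contained in [(V)] by
    the first claim: a contradiction.

    Finding that associated prime, as a maximal proper colon ideal containing
    [c], uses that the polynomial ring is Noetherian.  This is derived from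
    Dickson's lemma by comparing leading monomials ([ideal_chain_stops]). *)

(** * Ideals *)

(** The improper ideal is included, unlike in [idealr_closed]: colon ideals and
    the ideals of an ascending chain may be the whole ring. *)
Definition is_ideal (R : comNzRingType) (J : set R) : Prop :=
  J 0 /\ forall a u v, J u -> J v -> J (a * u + v).

Section Ideals.
Variable R : comNzRingType.
Implicit Types (A J P : set R) (x y : R).

Lemma is_idealD J x y : is_ideal J -> J x -> J y -> J (x + y).
Proof. by move=> [_ JD] Jx Jy; rewrite -(mul1r x); apply: JD. Qed.

Lemma is_idealM J a x : is_ideal J -> J x -> J (a * x).
Proof. by move=> [J0 JD] Jx; rewrite -(addr0 (a * x)); apply: JD. Qed.

Lemma is_idealB J x y : is_ideal J -> J x -> J y -> J (x - y).
Proof.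
by move=> idJ Jx Jy; apply: is_idealD => //; rewrite -mulN1r; apply: is_idealM.
Qed.

Lemma is_ideal_sum J (T : Type) (r : seq T) (Q : pred T) (F : T -> R) :
  is_ideal J -> (forall i, Q i -> J (F i)) -> J (\sum_(i <- r | Q i) F i).
Proof.
move=> idJ JF; elim/big_ind: _ => //; first by case: idJ.
by move=> x y; apply: is_idealD.
Qed.

Lemma is_ideal_gen A : is_ideal (ideal_gen A).
Proof.
split.
  by exists 0%N, (fun=> 0), (fun=> 0); split=> [//|[]//|]; rewrite big_ord0.
move=> c u v [n [b [a [_ Aa ->]]]] [n' [b' [a' [_ Aa' ->]]]].
exists (n + n')%N.
exists (fun i => match split i with inl j => c * b j | inr j => b' j end).
exists (fun i => match split i with inl j => a j | inr j => a' j end).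
split=> [//|i|]; first by case: (split i).
rewrite big_split_ord mulr_sumr; congr (_ + _); apply: eq_bigr => i _.
  by rewrite (unsplitK (inl i)) mulrA.
by rewrite (unsplitK (inr i)).
Qed.

Lemma sub_ideal_gen A : A `<=` ideal_gen A.
Proof.
by move=> x Ax; exists 1%N, (fun=> 1), (fun=> x); split; rewrite ?big_ord1 ?mul1r.
Qed.

Lemma ideal_gen_sub A J : is_ideal J -> A `<=` J -> ideal_gen A `<=` J.
Proof.
move=> idJ AJ x [n [b [a [_ Aa ->]]]].
by apply: is_ideal_sum => // i _; apply: is_idealM => //; apply: AJ.
Qed.

Lemma is_ideal_colon J x : is_ideal J -> is_ideal (colon J x).
Proof.
move=> [J0 JD]; rewrite /colon; split=> /=; first by rewrite mul0r.
by move=> a u v Ju Jv; rewrite mulrDl -mulrA; apply: JD.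
Qed.

Lemma prime_idealP P : prime_ideal P <->
  [/\ is_ideal P, ~ P 1 & forall x y, P (x * y) -> P x \/ P y].
Proof.
have inP x : (x \in [pred y | y \in P]) = `[< P x >] by [].
rewrite /prime_ideal /idealr_closed /prime_idealr_closed.
split=> [[[P0 P1 PD] PM]|[[P0 PD] P1 PM]].
- move: P0 P1; rewrite !inP => /asboolP P0 /asboolPn P1; split=> //.
    split=> // a u v Pu Pv; apply/asboolP; rewrite -inP.
    by apply: PD; rewrite inP; apply/asboolP.
  move=> x y Pxy; have := PM x y; rewrite !inP.
  by move=> /(_ (asboolT Pxy)) /orP[] /asboolP; [left | right].
- split; last first.
    move=> u v; rewrite !inP => /asboolP/PM[] /asboolT -> //.
    by rewrite orbT.
  rewrite !inP; split; [exact/asboolP | exact/asboolPn |].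
  move=> a u v; rewrite !inP => /asboolP Pu /asboolP Pv.
  exact/asboolP/PD.
Qed.

(** Being maximal forces primality: if [u * v] kills [x] modulo [J] but [u] does
    not, then [(J : x)] is contained in the proper colon ideal [(J : u * x)],
    hence equal to it, and the latter contains [v]. *)
Lemma maximal_colon_prime J x : is_ideal J -> ~ J x ->
    (forall y, ~ J y -> colon J x `<=` colon J y -> colon J y `<=` colon J x) ->
  associated_prime J (colon J x).
Proof.
move=> idJ Jx maxx; split; last by exists x.
apply/prime_idealP; split; first exact: is_ideal_colon.
  by rewrite /colon /= mul1r.
move=> u v Juvx; case: (pselect (J (u * x))) => [|Jux]; first by left.
right; apply: (maxx _ Jux) => [w Jwx|]; rewrite /colon /=.
  by rewrite mulrCA; apply: is_idealM.
by rewrite mulrCA mulrA.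
Qed.

Lemma prime_ideal_prod P (T : Type) (r : seq T) (F : T -> R) :
  prime_ideal P -> P (\prod_(i <- r) F i) -> exists i, P (F i).
Proof.
move=> /prime_idealP[_ P1 PM]; elim: r => [|i r IHr]; first by rewrite big_nil.
by rewrite big_cons => /PM[]; [exists i | apply: IHr].
Qed.

Lemma prime_idealX P x n : prime_ideal P -> P (x ^+ n) -> n != 0%N /\ P x.
Proof.
move=> /prime_idealP[_ P1 PM]; elim: n => [|n IHn]; first by rewrite expr0.
by rewrite exprS => /PM[//|/IHn[]].
Qed.

End Ideals.

(** * Noetherianity of polynomial rings *)

(** Each tail of the sequence attains its minimum; jumping from one such
    position to the one of the following tail gives the subsequence. *)
Lemma nondecreasing_subseq (u : nat -> nat) :
  exists2 phi : nat -> nat, {homo phi : i j / (i < j)%N} &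
    {homo u \o phi : i j / (i <= j)%N}.
Proof.
have min N : exists k, (N <= k)%N /\ forall j, (N <= j)%N -> (u k <= u j)%N.
  have ex : exists n, `[< exists2 k, (N <= k)%N & u k = n >].
    by exists (u N); apply/asboolP; exists N.
  case: (ex_minnP ex) => n /asboolP[k Nk <-] kmin.
  by exists k; split=> // j Nj; apply: kmin; apply/asboolP; exists j.
have [k kP] := choice min.
pose phi := fix phi n := if n is n'.+1 then k (phi n').+1 else k 0%N.
exists phi.
  apply: homo_ltn => [? ? ?|i]; first exact: ltn_trans.
  by have [] := kP (phi i).+1.
apply: homo_leq => [//|? ? ?|i]; first exact: leq_trans.
have lt_phi : (phi i < phi i.+1)%N by have [] := kP (phi i).+1.
case: i lt_phi => [|i] lt_phi /=; first by have [_] := kP 0%N; apply.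
have [lek min_k] := kP (phi i).+1.
by apply: min_k; apply: leq_trans lek (ltnW lt_phi).
Qed.

(** Dickson's lemma, by extracting a nondecreasing subsequence for one exponent
    after the other. *)
Lemma dickson (s : nat) (m : nat -> 'X_{1..s}) :
  exists i j, (i < j)%N /\ (m i <= m j)%MM.
Proof.
suff [phi phi_lt phi_le] : exists2 phi : nat -> nat,
    {homo phi : i j / (i < j)%N} &
    forall k, k \in enum 'I_s -> {homo (fun n => m (phi n) k) : i j / (i <= j)%N}.
  exists (phi 0%N), (phi 1%N); split; first exact: phi_lt.
  by apply/mnm_lepP => k; apply: phi_le => //; rewrite mem_enum.
elim: (enum 'I_s) => [|k l [phi phi_lt phi_le]]; first by exists id.
have [psi psi_lt psi_le] := nondecreasing_subseq (fun n => m (phi n) k).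
exists (phi \o psi) => [i j /psi_lt/phi_lt //|k'].
rewrite inE => /predU1P[->|k'l] i j ij; first exact: psi_le.
apply: (phi_le k' k'l); move: ij; rewrite leq_eqVlt => /predU1P[->//|].
by move/psi_lt/ltnW.
Qed.

Section Noetherian.
Variables (K : fieldType) (s : nat).
Implicit Types (p q : {mpoly K[s]}) (J : set {mpoly K[s]}).

Lemma exists_min_mlead (A : set {mpoly K[s]}) : A !=set0 ->
  exists2 p, A p & forall q, A q -> ~~ (mlead q < mlead p)%O.
Proof.
case=> p Ap; have [m] : exists m, mlead p = m by exists (mlead p).
elim/(well_founded_ind (@ltom_wf s)): m p Ap => m IHm p Ap pm.
case: (pselect (exists2 q, A q & (mlead q < mlead p)%O)) => [[q Aq qp]|nex].
  by apply: (IHm (mlead q) _ q) => //; rewrite -pm.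
by exists p => // q Aq; apply/negP => qp; apply: nex; exists q.
Qed.

Lemma mlead_cancel p q : mlead p = mlead q -> mleadc p = mleadc q ->
  p - q != 0 -> (mlead (p - q)%R < mlead p)%O.
Proof.
move=> eqm eqc nz; rewrite lt_neqAle; apply/andP; split.
  apply: contra nz => /eqP eqpq.
  by rewrite -mleadc_eq0 eqpq mcoeffB eqc eqm subrr.
by apply: (le_trans (mleadB_le p q)); rewrite -eqm joinxx.
Qed.

Lemma reduce_mlead p q : p != 0 -> q != 0 -> (mlead p <= mlead q)%MM ->
  exists a, q - a * p = 0 \/ (mlead (q - a * p)%R < mlead q)%O.
Proof.
move=> p0 q0 le_pq; pose c := mleadc q / mleadc p.
have lp0 : mleadc p != 0 by rewrite mleadc_eq0.
have lq0 : mleadc q != 0 by rewrite mleadc_eq0.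
have c0 : c != 0 by rewrite mulf_neq0 ?invr_eq0.
pose a := c *: 'X_[mlead q - mlead p] : {mpoly K[s]}.
have a0 : a != 0.
  rewrite scaler_eq0 negb_or c0 /=; apply/eqP => /(congr1 (fun r => msupp r)).
  by rewrite msuppX msupp0.
have mlap : mlead (a * p) = mlead q by rewrite mleadM // mleadZ // mleadXm submK.
exists a; case: (eqVneq (q - a * p) 0) => [|nz]; [by left | right].
apply: mlead_cancel => //.
by rewrite mleadM // mleadcM mleadZ // mleadXm mcoeffZ mcoeffX eqxx mulr1 divfK.
Qed.

(** The Hilbert basis theorem in the form of the ascending chain condition.  If
    every inclusion were strict, choose in each [J n.+1] a polynomial outside
    [J n] with least leading monomial.  Dickson's lemma gives two of them, an
    earlier one whose leading monomial divides that of a later one; reducing the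
    later by the earlier contradicts the minimality of the later. *)
Lemma ideal_chain_stops (J : nat -> set {mpoly K[s]}) :
    (forall n, is_ideal (J n)) -> (forall n, J n `<=` J n.+1) ->
  exists n, J n.+1 `<=` J n.
Proof.
move=> idJ Jinc; apply: contrapT => noex.
have step n : exists p, [/\ J n.+1 p, ~ J n p &
    forall q, J n.+1 q -> ~ J n q -> ~~ (mlead q < mlead p)%O].
  have [|p [Jp nJp] pmin] := @exists_min_mlead (J n.+1 `\` J n).
    apply: contrapT => /set0P/negP/negPn/eqP; rewrite setD_eq0 => sub.
    by apply: noex; exists n.
  by exists p; split=> // q Jq nJq; apply: pmin.
have {step}[f fP] := choice step.
have f0 n : f n != 0.
  by apply/eqP => fn0; have [_ + _] := fP n; rewrite fn0; case: (idJ n).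
have Jmono : {homo J : i j / (i <= j)%N >-> i `<=` j}.
  by apply: homo_leq => [A //|A B C AB BC x /AB/BC|].
have [i [j [ij dvd]]] := dickson (fun n => mlead (f n)).
have [Jfj nJfj fjmin] := fP j; have [Jfi _ _] := fP i.
have [a lt_a] := reduce_mlead (f0 i) (f0 j) dvd.
have Jafi : J j (a * f i) by apply: is_idealM => //; apply: (Jmono i.+1 j).
have nJ : ~ J j (f j - a * f i).
  by move=> Jr; apply: nJfj; rewrite -(subrK (a * f i) (f j)); apply: is_idealD.
case: lt_a => [r0|]; first by apply: nJ; rewrite r0; case: (idJ j).
by apply/negP; apply: fjmin => //; apply: is_idealB => //; apply: Jinc.
Qed.

(** A nonempty family without maximal member would contain a strictly ascending chain. *)
Lemma exists_maximal_ideal_in (F : set (set {mpoly K[s]})) :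
    (forall J, F J -> is_ideal J) -> F !=set0 ->
  exists2 J, F J & forall J', F J' -> J `<=` J' -> J' `<=` J.
Proof.
move=> idF [J0 FJ0]; apply: contrapT => nomax.
have step (J : {J | F J}) : exists J' : {J | F J},
    projT1 J `<=` projT1 J' /\ ~ (projT1 J' `<=` projT1 J).
  apply: contrapT => nex; apply: nomax; exists (projT1 J); first exact: projT2 J.
  move=> J' FJ' JJ'; apply: contrapT => nJ'J; apply: nex.
  by exists (exist _ J' FJ').
have {step}[next nextP] := choice step.
pose c n := iter n next (exist _ J0 FJ0).
have [n|n|n] := @ideal_chain_stops (fun n => projT1 (c n)).
- by apply: idF; exact: projT2 (c n).
- by have [] := nextP (c n).
- by have [] := nextP (c n).
Qed.

(** Zero divisors modulo [J] lie in associated primes: among the proper colon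
    ideals containing [c] there is a maximal one. *)
Lemma zero_divisor_in_associated_prime J c x : is_ideal J -> J (c * x) -> ~ J x ->
  exists2 P, associated_prime J P & P c.
Proof.
move=> idJ Jcx Jx.
pose F : set (set {mpoly K[s]}) :=
  [set P | exists y, [/\ ~ J y, J (c * y) & P = colon J y]].
have [_ [y [_ _ ->]]||_ [y [Jy Jcy ->]] ymax] := @exists_maximal_ideal_in F.
- exact: is_ideal_colon.
- by exists (colon J x), x.
exists (colon J y) => //; apply: maximal_colon_prime => // z Jz sub.
by apply: ymax => //; exists z; split=> //; apply: (sub c).
Qed.

End Noetherian.

(** * Variables and monomial primes *)

Section VariablesAndMonomials.
Variables (K : fieldType) (s : nat).
Implicit Types (V : {set 'I_s}) (p : {mpoly K[s]}) (P : set {mpoly K[s]}).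

Lemma poly_in_varsM V p q :
  poly_in_vars V p -> poly_in_vars V q -> poly_in_vars V (p * q).
Proof.
move=> Vp Vq m /msuppM_le /allpairsP[[m1 m2] /= [m1p m2q ->]] i.
rewrite mnmDE addn_eq0 negb_and => /orP[]; first exact: Vp.
exact: Vq.
Qed.

Lemma poly_in_varsD V p q :
  poly_in_vars V p -> poly_in_vars V q -> poly_in_vars V (p + q).
Proof.
move=> Vp Vq m /msuppD_le; rewrite mem_cat => /orP[]; first exact: Vp.
exact: Vq.
Qed.

Lemma poly_in_vars0 V : poly_in_vars V (0 : {mpoly K[s]}).
Proof. by move=> m; rewrite msupp0. Qed.

Lemma poly_in_vars_sum V (T : Type) (r : seq T) (F : T -> {mpoly K[s]}) :
  (forall i, poly_in_vars V (F i)) -> poly_in_vars V (\sum_(i <- r) F i).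
Proof.
move=> VF; elim/big_ind: _ => //; first exact: poly_in_vars0.
exact: poly_in_varsD.
Qed.

Lemma poly_in_varsS V V' p : V \subset V' ->
  poly_in_vars V p -> poly_in_vars V' p.
Proof. by move=> /fintype.subsetP VV' Vp m mp i mi; apply: VV'; apply: Vp mi. Qed.

Lemma mulX_in_other_vars (i : 'I_s) V p :
  i \notin V -> poly_in_vars V (p * 'X_i) -> p = 0.
Proof.
move=> iV Vp; apply/eqP; apply: contraNT iV => p0.
apply: (Vp (U_(i) + mlead p)%MM).
  by rewrite mcoeff_msupp mcoeffMX mleadc_eq0.
by rewrite mnmDE mnm1E eqxx.
Qed.

Lemma split_var (i : 'I_s) p :
  exists b r, p = b * 'X_i + r /\ poly_in_vars (~: [set i]) r.
Proof.
elim/mpolyind: p => [|c m p _ c0 [b [r [-> rP]]]].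
  exists 0, 0; split; last exact: poly_in_vars0.
  by rewrite mul0r addr0.
case: (eqVneq (m i) 0%N) => [mi0|mi0].
  exists b, (c *: 'X_[m] + r); split; first by rewrite addrCA.
  apply: poly_in_varsD => // m'; rewrite msuppMCX // inE => /eqP-> j mj.
  by rewrite !inE; apply: contraNneq mj => ->; rewrite mi0.
exists (c *: 'X_[m - U_(i)] + b), r; split=> //.
by rewrite mulrDl -scalerAl -mpolyXD submK ?lep1mP // addrA.
Qed.

(** Write [S] for the polynomial ring and [I'] for the ideal of [K[V]] generated
    by [A].  Then the quotient of [S] by the ideal generated by [A] is the ring
    of polynomials in the variables outside [V] over [K[V]/I'], where such a
    variable is not a zero divisor.  Concretely, write each coefficient of a
    combination of generators as a multiple of the variable plus a remainder
    free of it: the contributions of the remainders must cancel. *)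
Lemma var_regular_mod V (A : set {mpoly K[s]}) (i : 'I_s) p :
    A `<=` poly_in_vars V -> i \notin V ->
  ideal_gen A ('X_i * p) -> ideal_gen A p.
Proof.
move=> AV iV [n [b [a [_ Aa eqp]]]].
have [b' b'P] := choice (fun k => split_var i (b k)).
have {b'P}[r b'P] := choice b'P.
have -> : p = \sum_(k < n) b' k * a k.
  apply/eqP; rewrite -subr_eq0; apply/eqP.
  apply: (@mulX_in_other_vars i (~: [set i])); first by rewrite !inE eqxx.
  have -> : (p - \sum_(k < n) b' k * a k) * 'X_i = \sum_(k < n) r k * a k.
    rewrite mulrBl [p * _]mulrC eqp mulr_suml -sumrB.
    apply: eq_bigr => k _; have [-> _] := b'P k.
    by rewrite mulrDl [b' k * 'X_i * _]mulrAC addrC addKr.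
  apply: poly_in_vars_sum => k; apply: poly_in_varsM; first by have [] := b'P k.
  apply: poly_in_varsS (AV _ (Aa k)); apply/fintype.subsetP => j jV.
  by rewrite !inE; apply: contraNneq iV => <-.
apply: is_ideal_sum; first exact: is_ideal_gen.
by move=> k _; apply: is_idealM; [exact: is_ideal_gen | exact: sub_ideal_gen].
Qed.

(** A monomial is a product of variables, one of which a prime must contain. *)
Lemma prime_ideal_monomial P (m : 'X_{1..s}) : prime_ideal P ->
  P 'X_[m] -> exists2 i, m i != 0%N & P 'X_i.
Proof.
rewrite mpolyXE_id => primeP /(prime_ideal_prod primeP)[i].
by move=> /(prime_idealX primeP)[mi Pi]; exists i.
Qed.

Lemma monomial_in_vars_ideal V (m : 'X_{1..s}) (i : 'I_s) :
  i \in V -> m i != 0%N -> vars_ideal V ('X_[m] : {mpoly K[s]}).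
Proof.
move=> iV mi; rewrite -(@submK _ U_(i)%MM m) ?lep1mP // mpolyXD.
apply: is_idealM; first exact: is_ideal_gen.
by apply: sub_ideal_gen; exists i.
Qed.

(** A monomial prime is generated by variables, and a variable outside [V]
    cannot lie in a proper colon ideal of [I] since it is regular modulo [I]. *)
Lemma associated_prime_sub_vars V (A P : set {mpoly K[s]}) :
    A `<=` poly_in_vars V -> associated_prime (ideal_gen A) P ->
  generated_by_monomials P -> P `<=` vars_ideal V.
Proof.
move=> AV [primeP [x Px]] [M PM]; rewrite PM.
apply: ideal_gen_sub; first exact: is_ideal_gen.
move=> _ [m Mm ->].
have [|i mi PXi] := @prime_ideal_monomial P m primeP.
  by rewrite PM; apply: sub_ideal_gen; exists m.
apply: (@monomial_in_vars_ideal V m i) => //.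
apply: contrapT => /negP iV.
have [_ P1 _] := (prime_idealP P).1 primeP; apply: P1.
move: PXi; rewrite Px /colon /= mul1r => XIx; exact: (var_regular_mod AV iV XIx).
Qed.

Definition kill_vars V p : {mpoly K[s]} :=
  p \mPo [tuple (if i \in V then 0 else 'X_i) | i < s].

HB.instance Definition _ V := GRing.RMorphism.copy (kill_vars V)
  (comp_mpoly [tuple (if i \in V then 0 else 'X_i) | i < s]).

Lemma kill_varsXi V i : kill_vars V 'X_i = if i \in V then 0 else 'X_i.
Proof. by rewrite /kill_vars comp_mpolyXU -tnth_nth tnth_mktuple. Qed.

Lemma kill_varsX V m : kill_vars V 'X_[m] =
  if [exists i in V, m i != 0%N] then 0 else 'X_[m].
Proof.
rewrite /kill_vars comp_mpolyX; case: ifPn => [/exists_inP[i iV mi]|].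
  by rewrite (bigD1 i) //= tnth_mktuple iV expr0n (negbTE mi) mul0r.
rewrite negb_exists_in => /forall_inP noV; rewrite mpolyXE_id.
apply: eq_bigr => i _; rewrite tnth_mktuple; case: ifP => // iV.
by have := noV i iV; rewrite negbK => /eqP->.
Qed.

Lemma kill_vars_congr V p : vars_ideal V (p - kill_vars V p).
Proof.
have idN := is_ideal_gen [set p : {mpoly K[s]} | exists2 i, i \in V & p = 'X_i].
elim/mpolyind: p => [|c m p _ _ IHp]; first by rewrite rmorph0 subrr; case: idN.
rewrite rmorphD /= {1}/kill_vars comp_mpolyZ opprD addrACA.
apply: is_idealD => //; rewrite -scalerBr -mul_mpolyC; apply: is_idealM => //.
rewrite -/(kill_vars V _) kill_varsX.
case: ifP => [/exists_inP[i iV mi]|_]; last by rewrite subrr; case: idN.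
by rewrite subr0; apply: monomial_in_vars_ideal mi.
Qed.

Lemma vars_idealP V p : vars_ideal V p <-> kill_vars V p = 0.
Proof.
split=> [|p0]; last by have := kill_vars_congr V p; rewrite p0 subr0.
apply: (@ideal_gen_sub _ _ [set p | kill_vars V p = 0]) => [|_ [i iV ->]] /=;
  last first.
  by rewrite kill_varsXi iV.
split=> [|a u v /= u0 v0]; first exact: rmorph0.
by rewrite /= rmorphD rmorphM /= u0 v0 mulr0 addr0.
Qed.

(** The quotient by [(V)] is again a polynomial ring, hence a domain. *)
Lemma vars_ideal_prime V : prime_ideal (@vars_ideal K s V).
Proof.
apply/prime_idealP; split; first exact: is_ideal_gen.
  by move/vars_idealP/eqP; rewrite rmorph1 oner_eq0.
move=> p q /vars_idealP/eqP; rewrite rmorphM mulf_eq0 => /orP[]/eqP/vars_idealP.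
  by left.
by right.
Qed.

End VariablesAndMonomials.

(** * Contraction from a localization *)

Section Localization.
Variable R : idomainType.
Implicit Types (N I : set R) (x : R).

(** The contraction is the union of the [(I : c)] with [c] outside [N]: the
    product of the finitely many denominators of a combination is again outside
    the prime [N], and [R] embeds in its fraction field. *)
Lemma contraction_extensionP N I x : prime_ideal N -> is_ideal I ->
  contraction (extension N I) x <-> exists2 c, ~ N c & I (c * x).
Proof.
move=> /prime_idealP[idN N1 NM] idI; split; last first.
  move=> [c Nc Icx]; exists 1%N, (fun=> tofrac 1 / tofrac c), (fun=> tofrac (c * x)).
  split=> [_|_|]; first by exists 1, c.
    by exists (c * x).
  rewrite big_ord1 tofrac1 mul1r tofracM mulKf // tofrac_eq0.
  by apply: contra_notN Nc => /eqP->; case: idN.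
move=> [n [b [a [locb Ia eqx]]]].
suff [c Nc [y Iy eqy]] : exists2 c, ~ N c &
    exists2 y, I y & tofrac c * \sum_(i < n) b i * a i = tofrac y.
  exists c => //; suff -> : c * x = y by [].
  by apply/eqP; rewrite -tofrac_eq tofracM eqx eqy.
move: locb Ia => {x eqx}; elim: n b a => [|n IHn] b a locb Ia.
  by exists 1 => //; exists 0; [case: idI | rewrite big_ord0 mulr0 tofrac0].
have [|//|c Nc [y Iy eqy]] := IHn (fun i => b (lift ord0 i)) (fun i => a (lift ord0 i)).
  by move=> i; apply: locb.
have [u [d [Nd eqb]]] := locb ord0; have [z Iz eqz] := Ia ord0.
have d0 : tofrac d != 0.
  by rewrite tofrac_eq0; apply: contra_notN Nd => /eqP->; case: idN.
exists (c * d); first by move/NM => [].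
exists (c * u * z + d * y); first by apply: is_idealD => //; apply: is_idealM.
rewrite big_ord_recl /= eqb -eqz tofracD !tofracM -eqy mulrDr; congr (_ + _).
  by rewrite -!mulrA; congr (_ * _); rewrite mulrCA mulVKf.
by rewrite mulrCA mulrA.
Qed.

End Localization.

(** * Associated primes generated by monomials *)

Theorem proposition3p3 (K : fieldType) (s : nat) (V : {set 'I_s})
    (q : nat) (f : 'I_q -> {mpoly K[s]})
    (hf : forall j, poly_in_vars V (f j))
    (I : set {mpoly K[s]}) (hI : I = ideal_gen (range f))
    (hmon : forall P : set {mpoly K[s]},
        associated_prime I P -> generated_by_monomials P) :
  (forall P : set {mpoly K[s]}, associated_prime I P -> P `<=` vars_ideal V) /\
  contraction (extension (vars_ideal V) I) = I.
Proof.
have assP P : associated_prime I P -> P `<=` vars_ideal V.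
  move=> aP; have := hmon P aP; move: aP; rewrite hI.
  by apply: associated_prime_sub_vars => _ [j _ <-].
split=> //.
have idI : is_ideal I by rewrite hI; exact: is_ideal_gen.
have primeN := @vars_ideal_prime K s V.
apply/seteqP; split=> x; last first.
  move=> Ix; apply/(contraction_extensionP _ primeN idI).
  by exists 1; [case/prime_idealP: primeN | rewrite mul1r].
move=> /(contraction_extensionP _ primeN idI)[c Nc Icx].
apply: contrapT => nIx; apply: Nc.
by have [P /assP PN /PN] := zero_divisor_in_associated_prime idI Icx nIx.
Qed.
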